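(* Every identifying code $S$ in $\mathrm{C}_\infty(1,3)$ has density $\rho(S)\ge 4/11$.
   Context: The infinite circulant graph $\mathrm{C}_\infty(1,3)$ has vertex set $\mathbb{Z}$ and edges $xy$ with $|x-y|\in\{1,3\}$. For $u\in\mathbb{Z}$, $N[u]=\{u,u\pm1,u\pm3\}$, and for $S\subseteq\mathbb{Z}$, $S_u=N[u]\cap S$. A set $S\subseteq\mathbb{Z}$ is an identifying code if the sets $S_u$, $u\in\mathbb{Z}$, are all nonempty and pairwise distinct. The density of $S\subseteq\mathbb{Z}$ is $\rho(S)=\limsup_{N\to\infty}\frac{|S\cap[-N,N]|}{2N+1}$. *)

(* Defs.v *)
From mathcomp Require Export all_boot all_order all_algebra finmap.
From mathcomp Require Import zify.
From mathcomp Require Export all_classical all_reals.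
From mathcomp Require Export ereal topology normedtype sequences.

Set Implicit Arguments.
Unset Strict Implicit.
Unset Printing Implicit Defensive.

Import Order.TTheory GRing.Theory Num.Theory.
Import numFieldNormedType.Exports.

Local Open Scope classical_set_scope.
Local Open Scope ring_scope.

Definition C13_adj : rel int :=
  fun x y => absz (x - y) \in [:: 1; 3]%N.

Definition C13_closed_nbhd (u : int) : set int :=
  [set v | v = u \/ C13_adj u v].

Lemma C13_closed_nbhdE (u : int) :
  C13_closed_nbhd u = [set u; u + 1; u - 1; u + 3; u - 3].
Proof.
apply/seteqP; split=> v; rewrite /C13_closed_nbhd /C13_adj /= !inE; lia.
Qed.

Definition code_trace (S : set int) (u : int) : set int :=
  C13_closed_nbhd u `&` S.

Definition identifying_code (S : set int) : Prop :=
  (forall u, code_trace S u !=set0) /\ injective (code_trace S).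

Definition window (N : nat) : set int := `[- N%:Z, N%:Z]%classic.

(* [fset_set] is only meaningful on finite sets. *)
Lemma finite_windowI (S : set int) (N : nat) : finite_set (S `&` window N).
Proof.
apply: (@sub_finite_set _ _ [set i%:Z - N%:Z | i in `I_(N.*2.+1)]).
  move=> x [_]; rewrite /window /= in_itv /= => /andP[h1 h2].
  by exists (absz (x + N%:Z)) => /=; lia.
exact/finite_image/finite_II.
Qed.

Definition window_card (S : set int) (N : nat) : nat :=
  #|` fset_set (S `&` window N)|%fset.

Definition density (R : realType) (S : set int) : \bar R :=
  limn_esup (fun N : nat => ((window_card S N)%:R / (N.*2.+1)%:R)%:E).

(* Main.v *)
(** Read [S] as a two-sided binary word and slide a window of length 11 along
    it.  The conditions that involve only the five central vertices of a window
    already force the density: among the words all of whose windows satisfy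
    them, [11 * (number of ones) - 4 * length] is bounded below.  The bound is
    certified by a potential (the "deficit") on words of length 10, i.e. by the
    absence of negative cycles in the transfer graph whose edges are the
    admissible windows, weighted by [11 * (new letter) - 4]. *)

Require Import Defs.
From mathcomp Require Import zify lra.

Local Open Scope classical_set_scope.
Local Open Scope ring_scope.

Set Implicit Arguments.
Unset Strict Implicit.
Unset Printing Implicit Defensive.

Import Order.TTheory GRing.Theory Num.Theory.
Import numFieldNormedType.Exports.

Section Words.
Local Open Scope nat_scope.

Fixpoint forall_words (n : nat) (P : pred (seq bool)) : bool :=
  if n is m.+1 then
    forall_words m (fun w => P (false :: w)) &&
    forall_words m (fun w => P (true :: w))
  else P [::].

Lemma forall_wordsP (n : nat) (P : pred (seq bool)) (w : seq bool) :
  forall_words n P -> size w = n -> P w.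
Proof.
elim: n P w => [|n IHn] P [|b w] //= /andP[Pf Pt] [sw].
by case: b; [exact: IHn Pt sw | exact: IHn Pf sw].
Qed.

(** A binary trie indexed by words, so that under [vm_compute] a lookup costs at most the length of
    the word. *)
Inductive word_table := Entry of nat | Branch of word_table & word_table.

Fixpoint lookup (t : word_table) (w : seq bool) : nat :=
  match t, w with
  | Entry d, _ => d
  | Branch l r, b :: w' => lookup (if b then r else l) w'
  | Branch _ _, [::] => 0
  end.

Fixpoint tabulate (n : nat) (f : seq bool -> nat) : word_table :=
  if n is m.+1 then
    Branch (tabulate m (fun w => f (false :: w)))
           (tabulate m (fun w => f (true :: w)))
  else Entry (f [::]).

(** Used only for [u] from 3 to 7, where the subtractions do not truncate and all positions fit in a
    word of length 11. *)
Definition word_trace (w : seq bool) (u : nat) : seq nat :=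
  [seq p <- [:: u - 3; u - 1; u; u + 1; u + 3] | nth false w p].

Definition identifying_word (w : seq bool) : bool :=
  let traces := [seq word_trace w u | u <- iota 3 5] in
  ([::] \notin traces) && uniq traces.

(** One Bellman-Ford round for longest paths; [b] is the letter that leaves the window. Truncated
    subtraction lets a path restart at any word with deficit 0. *)
Definition relax_deficit (t : word_table) : word_table :=
  let step w b :=
    if identifying_word (b :: w)
    then lookup t (take 10 (b :: w)) + 4 - 11 * last false w else 0 in
  tabulate 10 (fun w =>
    maxn (lookup t w) (maxn (step w false) (step w true))).

(* The entry at [w] is the maximum of [4 * n - 11 * k] over the locally
   identifying words of length [10 + n] that end in [w], [k] being the number
   of ones among the last [n] letters.  27 rounds reach the fixpoint. *)
Definition deficit_table : word_table :=
  Eval vm_compute in iter 27 relax_deficit (Entry 0).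

Lemma lookup_deficit_le (w : seq bool) :
  size w = 10 -> lookup deficit_table w <= 24.
Proof.
apply: (@forall_wordsP 10 (fun w => lookup deficit_table w <= 24)).
by vm_compute.
Qed.

Lemma deficit_step (w : seq bool) : size w = 11 -> identifying_word w ->
  lookup deficit_table (take 10 w) + 4 <=
  lookup deficit_table (behead w) + 11 * last false w.
Proof.
move=> sw; apply/implyP; move: w sw => w.
apply: (@forall_wordsP 11 (fun w => identifying_word w ==>
  (lookup deficit_table (take 10 w) + 4 <=
   lookup deficit_table (behead w) + 11 * last false w))).
by vm_compute.
Qed.

(** The inequalities [deficit_step] telescope; the initial deficit is nonnegative and the final one
    at most 24. The first ten letters only form the initial word, so counting starts at 10. *)
Lemma identifying_words_count (a : nat -> bool) :
    (forall i, identifying_word (mkseq (fun j => a (i + j)) 11)) ->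
  forall n, 4 * n <= 24 + 11 * count a (iota 10 n).
Proof.
move=> a_id n; pose d i := lookup deficit_table (mkseq (fun j => a (i + j)) 10).
suff: d 0 + 4 * n <= d n + 11 * count a (iota 10 n).
  have : d n <= 24 by apply: lookup_deficit_le; rewrite size_mkseq.
  lia.
elim: n => [|n IHn]; first by rewrite !muln0.
have : d n + 4 <= d n.+1 + 11 * a (10 + n).
  have := deficit_step (size_mkseq _ _) (a_id n).
  congr (_ <= lookup _ _ + 11 * _); last by rewrite /= addnC.
  by rewrite /d /mkseq /= !addSnnS.
have -> : iota 10 n.+1 = iota 10 n ++ [:: 10 + n].
  by rewrite -[n.+1]addn1 iotaD.
rewrite count_cat /=; lia.
Qed.

End Words.

Definition code_word (S : set int) (x : int) : seq bool :=
  mkseq (fun j => `[< S (x + j%:Z) >]) 11.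

Lemma code_traceE (S : set int) (x : int) (u : nat) : u \in iota 3 5 ->
  code_trace S (x + u%:Z) =
  [set x + p%:Z | p in [set` word_trace (code_word S x) u]].
Proof.
rewrite mem_iota => /andP[u3 u8]; rewrite /code_trace C13_closed_nbhdE.
have nthS p : (p < 11)%N -> nth false (code_word S x) p = `[< S (x + p%:Z) >].
  by move=> p11; rewrite nth_mkseq.
apply/seteqP; split=> v /=.
- move=> [vu Sv]; exists `|v - x|%N; last by lia.
  rewrite mem_filter nthS; last by lia.
  have -> : x + `|v - x|%N%:Z = v by lia.
  by apply/andP; split; [exact/asboolP | rewrite !inE; lia].
- move=> [p]; rewrite mem_filter => /andP[]; rewrite !inE => Sp pu <-.
  move: Sp; rewrite nthS; last by lia.
  by move=> /asboolP Sp; split=> //; lia.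
Qed.

Lemma identifying_code_word (S : set int) (x : int) :
  identifying_code S -> identifying_word (code_word S x).
Proof.
move=> [S_dom S_sep]; apply/andP; split.
- apply/negP => /mapP[u u_in u_nil].
  by have [v] := S_dom (x + u%:Z); rewrite code_traceE// -u_nil => -[].
- rewrite map_inj_in_uniq ?iota_uniq// => u v u_in v_in uv.
  have : code_trace S (x + u%:Z) = code_trace S (x + v%:Z).
    by rewrite !code_traceE// uv.
  by move=> /S_sep; lia.
Qed.

Lemma identifying_code_window_card (S : set int) (N : nat) :
  identifying_code S -> (4 * N.*2.+1 <= 24 + 11 * window_card S N)%N.
Proof.
(* With this shift, the counted positions [10, ..., 10 + 2N] are the integers from [-N] to [N]. *)
move=> S_id; pose c := - N%:Z - 10; pose a i := `[< S (c + i%:Z) >].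
apply: leq_trans (_ : _ <= 24 + 11 * count a (iota 10 N.*2.+1))%N _.
  apply: identifying_words_count => i.
  have := identifying_code_word (c + i%:Z) S_id; congr identifying_word.
  by apply: eq_map => j; rewrite /a PoszD addrA.
rewrite leq_add2l leq_mul2l -size_filter.
rewrite -(size_map (fun i : nat => c + i%:Z)) /window_card.
apply/orP; right; apply: uniq_leq_size.
  rewrite map_inj_uniq ?filter_uniq ?iota_uniq// => i j; lia.
move=> v /mapP[i]; rewrite mem_filter mem_iota => /andP[/asboolP Si i_in] ->.
rewrite in_fset_set ?inE; last exact: finite_windowI.
by split=> //; rewrite /window/= in_itv/=; lia.
Qed.

(** Each tail supremum of [u] from [n] on is at least [u n], hence at least [v n]. *)
Lemma le_limn_esup_cvg (R : realType) (u v : (\bar R)^nat) (l : \bar R) :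
  (forall n, v n <= u n)%E -> v @ \oo --> l -> (l <= limn_esup u)%E.
Proof.
move=> vu vl; rewrite limn_esup_lim -(cvg_lim _ vl)//.
apply: lee_lim; first by apply/cvg_ex; exists l.
  exact: is_cvg_esups.
apply: nearW => n; apply: le_trans (vu n) _.
by apply: ereal_sup_ubound; exists n => /=.
Qed.

Theorem theorem5 (R : realType) (S : set int) (hS : identifying_code S) :
  ((4 / 11 : R)%:E <= density R S)%E.
Proof.
(* The error [24 / (11 (2N + 1))] is at most [3 / (N + 1)], that is [3 * harmonic N]. *)
apply: (@le_limn_esup_cvg _ _ (fun N => (4 / 11 - 3 * harmonic N)%:E)).
- move=> N; rewrite lee_fin /harmonic /=.
  have n0 : 0 < (N.*2.+1)%:R :> R by rewrite ltr0n.
  have m0 : 0 < (N.+1)%:R :> R by rewrite ltr0n.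
  have key : 4 * (N.*2.+1)%:R <= 24 + 11 * (window_card S N)%:R :> R.
    by rewrite -!natrM -natrD ler_nat identifying_code_window_card.
  have nm : (N.+1)%:R <= (N.*2.+1)%:R :> R by rewrite ler_nat; lia.
  rewrite ler_pdivlMr//.
  move: (N.*2.+1)%:R (N.+1)%:R n0 m0 key nm => n m n0 m0 key nm.
  have : 1 <= m^-1 * n by rewrite mulrC ler_pdivlMr ?mul1r.
  lra.
- apply: cvg_EFin; first by near=> n.
  rewrite -[X in _ --> X]subr0 -[X in _ - X](mulr0 3).
  by apply: cvgB; [exact: cvg_cst | apply: cvgMr; exact: cvg_harmonic].
Unshelve. all: by end_near.
Qed.
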